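(* For all $t>0$, let $\mathbf x_t^*$ be an optimal solution of problem $(\mathcal P_t^5)$, let $\mathbf x_{\eta,t}^*$ be the primal part of the unique saddle point of the regularized problem $\max_{\bm\lambda\ge0}\min_{\mathbf x}\mathcal L_{\phi,v,t}(\mathbf x,\bm\lambda)$ with $\phi>0$, $v>0$, and let $\bm\lambda_{v,t}^*$ and $\bm\lambda_{\eta,t}^*$ be dual optimal solutions of that saddle-point problem for ($\phi=0$, $v>0$) and ($\phi>0$, $v>0$), respectively (same $v$). Then $$\|\mathbf x_t^*-\mathbf x_{\eta,t}^*\|_2^2\le\left(\frac{2\big(G_f+G_g\|\bm\lambda_{v,t}^*\|_1\big)}{c}\right)^2+\frac{\phi}{2c}\left(\|\bm\lambda_{v,t}^*\|_2^2-\|\bm\lambda_{\eta,t}^*\|_2^2\right).$$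
   Context: Network: $N$ nodes $\mathcal N=\{1,\dots,N\}$. For $\mathbf w=[\mathbf p^\top,\mathbf q^\top]^\top\in\mathbb R^{2N}$, $\mathbf v(\mathbf w)=\mathbf R\mathbf p+\mathbf X\mathbf q+\mathbf v_0\in\mathbb R^N$ with fixed $\mathbf R,\mathbf X\in\mathbb R^{N\times N}$, $\mathbf v_0\in\mathbb R^N$. Limits $\mathbf v^{\min},\mathbf v^{\max}\in\mathbb R^N$. $\mathcal X_t\subset\mathbb R^{2N}$ is convex and compact. $C_t^{\mathrm{OPF}}:\mathbb R^{2N}\to\mathbb R$ is continuously differentiable and strongly convex, with gradient bounded on $\mathcal X_t$. For $\mathbf z=[\tilde{\mathbf p}^\top,\tilde{\mathbf q}^\top]^\top$, $$C_t^{\mathrm{SE}}(\mathbf z)=\sum_{i\in\mathcal M_p}\frac{(\hat p_{i,t}-\tilde p_i)^2}{2(\sigma^p_{i,t})^2}+\sum_{i\in\mathcal M_q}\frac{(\hat q_{i,t}-\tilde q_i)^2}{2(\sigma^q_{i,t})^2}+\sum_{i\in\mathcal M_v}\frac{(\hat v_{i,t}-\mathbf v(\mathbf z)_i)^2}{2(\sigma^v_{i,t})^2},$$ with given measurements, positive standard deviations, $\mathcal M_p=\mathcal M_q=\mathcal N$, $\mathcal M_v\subseteq\mathcal N$. Constraint functions: given samples $\bm\xi_t^1,\dots,\bm\xi_t^{N_s}\in\mathbb R^N$ and $\beta\in(0,1)$, for $\bm\tau=[\underline{\bm\tau}^\top,\overline{\bm\tau}^\top]^\top\in\mathbb R_+^{2N}$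 let $\mathbf g_t(\mathbf u,\bm\tau)=[\overline{\mathbf g}_t^\top,\underline{\mathbf g}_t^\top]^\top\in\mathbb R^{2N}$, where $$\overline{\mathbf g}_t=\frac1{N_s}\sum_{s=1}^{N_s}[\mathbf v(\mathbf u)-\mathbf v^{\max}+\bm\xi_t^s+\overline{\bm\tau}]_+-\beta\overline{\bm\tau},\qquad \underline{\mathbf g}_t=\frac1{N_s}\sum_{s=1}^{N_s}[\mathbf v^{\min}-\mathbf v(\mathbf u)-\bm\xi_t^s+\underline{\bm\tau}]_+-\beta\underline{\bm\tau},$$ and $[\cdot]_+=\max\{0,\cdot\}$ componentwise. Write $\mathbf x=[\mathbf u^\top,\mathbf z^\top,\bm\tau^\top]^\top$ and $\mathbf g_t(\mathbf x)=\mathbf g_t(\mathbf u,\bm\tau)$. Problem $(\mathcal P_t^5)$: minimize $C_t^{\mathrm{OPF}}(\mathbf u)+C_t^{\mathrm{SE}}(\mathbf z)$ over $\mathbf x\in\mathcal X_t\times\mathcal X_t\times\mathbb R_+^{2N}$ subject to $\mathbf g_t(\mathbf u,\bm\tau)\le0$ and $\mathbf v(\mathbf u)=\mathbf v(\mathbf z)$. Regularized Lagrangian: for $\bm\lambda\in\mathbb R_+^{2N}$, $\mathcal L_{\phi,v,t}(\mathbf x,\bm\lambda)=C_t^{\mathrm{OPF}}(\mathbf u)+C_t^{\mathrm{SE}}(\mathbf z)+\bm\lambda^\top\mathbf g_t(\mathbf u,\bm\tau)+\frac v2\|\bm\tau\|_2^2-\frac\phi2\|\bm\lambda\|_2^2$,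 with $v>0$ a scalar constant. The associated saddle-point problem is $\max_{\bm\lambda\in\mathbb R_+^{2N}}\min_{\mathbf x\in\mathcal X_t\times\mathcal X_t\times\mathbb R_+^{2N}}\mathcal L_{\phi,v,t}(\mathbf x,\bm\lambda)$; $\eta=(\phi,v)$. Assumptions: (Slater) for all $t>0$ there exist $\mathbf u\in\mathcal X_t$, $\bm\tau\in\mathbb R_+^{2N}$ with $\mathbf g_t(\mathbf u,\bm\tau)\le0$; consequently the dual optimal sets are taken to be nonempty, and $\bm\lambda_{v,t}^*$, $\bm\lambda^*_{\eta,t}$ are arbitrary but fixed elements of them. Let $\tilde f_t(\mathbf x)=C_t^{\mathrm{OPF}}(\mathbf u)+C_t^{\mathrm{SE}}(\mathbf z)+\frac v2\|\bm\tau\|_2^2$; $c>0$ is a strong convexity constant of $\tilde f_t$, i.e. $\tilde f_t(\mathbf y)\ge\tilde f_t(\mathbf x)+\nabla\tilde f_t(\mathbf x)^\top(\mathbf y-\mathbf x)+\frac c2\|\mathbf y-\mathbf x\|_2^2$. $G_f,G_g>0$ are constants with $\|\nabla_{\mathbf x}\tilde f_t(\mathbf x)\|_2\le G_f$ and $\|\nabla_{\mathbf x}\mathbf g_t(\mathbf x)\|_2\le G_g$ for all $\mathbf x\in\mathcal X_t\times\mathcal X_t\times\mathbb R_+^{2N}$ and $t>0$, where $\nabla_{\mathbf x}\mathbf g_t(\mathbf x)$ is any matrix whose $j$-th row is a subgradient of the $j$-th component of $\mathbf g_t$ at $\mathbf x$.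
   Formalization: The bound G_f on the gradient cannot hold for all τ ≥ 0 (the gradient contains vτ); it is required only at points whose τ lies in a set T_t that contains the τ-part of x_t^*. Taking T_t to be the whole space gives the literal statement. *)

(* Defs.v *)
From HB Require Import structures.
From mathcomp Require Import all_boot all_order all_algebra.
From mathcomp Require Import all_classical all_reals all_analysis.

Set Implicit Arguments.
Unset Strict Implicit.
Unset Printing Implicit Defensive.

Import Order.TTheory GRing.Theory Num.Theory.
Import numFieldNormedType.Exports.

Local Open Scope classical_set_scope.
Local Open Scope ring_scope.

Section Euclidean.
Context {R : realType}.

Definition dot n (x y : 'cV[R]_n) : R := (x^T *m y) 0 0.

(* The library norm on matrices is the sup norm (it induces the same topology,
   compactness and derivatives), hence the explicit l1 and l2 norms. *)
Definition norm1 n (x : 'cV[R]_n) : R := \sum_i `|x i 0|.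
Definition norm2 n (x : 'cV[R]_n) : R := Num.sqrt (\sum_i x i 0 ^+ 2).

(* Spectral norm. *)
Definition opnorm2 m n (J : 'M[R]_(m, n)) : R :=
  sup [set norm2 (J *m x) | x in [set x : 'cV[R]_n | norm2 x <= 1]].

Definition lev n (x y : 'cV[R]_n) : Prop := forall i, x i 0 <= y i 0.
Definition orthant n : set 'cV[R]_n := [set x | lev 0 x].
Definition pospart n (x : 'cV[R]_n) : 'cV[R]_n := map_mx (Num.max 0) x.

Definition grad n (f : 'cV[R]_n -> R) (x : 'cV[R]_n) : 'cV[R]_n :=
  \col_i 'D_(delta_mx i 0) f x.

Definition C1 n (f : 'cV[R]_n -> R) : Prop :=
  (forall x, differentiable f x) /\ continuous (grad f).

Definition strongly_convex_on n (A : set 'cV[R]_n) (c : R)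
    (f : 'cV[R]_n -> R) : Prop :=
  forall x y, A x -> A y ->
    f x + dot (grad f x) (y - x) + c / 2 * norm2 (y - x) ^+ 2 <= f y.

Definition subgradient n (f : 'cV[R]_n -> R) (x s : 'cV[R]_n) : Prop :=
  forall y, f x + dot s (y - x) <= f y.

Definition subgradient_mx m n (g : 'cV[R]_n -> 'cV[R]_m) (x : 'cV[R]_n)
    (J : 'M[R]_(m, n)) : Prop :=
  forall j, subgradient (fun y => g y j 0) x (row j J)^T.

End Euclidean.

Record network (R : realType) (N : nat) := Network {
  Rmat : 'M[R]_N;
  Xmat : 'M[R]_N;
  v0 : 'cV[R]_N;
  vmin : 'cV[R]_N;
  vmax : 'cV[R]_N;
  Mv : {set 'I_N};
  beta : R
}.

(* Data that depend on the time step; [Ns] is the number of samples. *)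
Record stage (R : realType) (N Ns : nat) := Stage {
  Xset : set 'cV[R]_(N + N);
  Copf : 'cV[R]_(N + N) -> R;
  phat : 'I_N -> R;
  qhat : 'I_N -> R;
  vhat : 'I_N -> R;
  sigp : 'I_N -> R;
  sigq : 'I_N -> R;
  sigv : 'I_N -> R;
  xi : 'I_Ns -> 'cV[R]_N
}.

Section Blocks.
Context {R : realType} {N : nat}.

(* x is the concatenation of u, z and tau, each in R^(2N). *)
Implicit Type x : 'cV[R]_((N + N) + (N + N) + (N + N)).

Definition ublk x : 'cV[R]_(N + N) := usubmx (usubmx x).
Definition zblk x : 'cV[R]_(N + N) := dsubmx (usubmx x).
Definition taublk x : 'cV[R]_(N + N) := dsubmx x.

End Blocks.

Section Problem.
Context {R : realType} {N Ns : nat}.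
Variables (net : network R N) (st : stage R N Ns).

Local Notation var := 'cV[R]_((N + N) + (N + N) + (N + N)).

Definition volt (w : 'cV[R]_(N + N)) : 'cV[R]_N :=
  Rmat net *m usubmx w + Xmat net *m dsubmx w + v0 net.

(* Active and reactive power are measured at every node; voltage magnitudes at
   the nodes of [Mv] only. *)
Definition Cse (z : 'cV[R]_(N + N)) : R :=
  \sum_i (phat st i - usubmx z i 0) ^+ 2 / (2 * sigp st i ^+ 2) +
  \sum_i (qhat st i - dsubmx z i 0) ^+ 2 / (2 * sigq st i ^+ 2) +
  \sum_(i in Mv net) (vhat st i - volt z i 0) ^+ 2 / (2 * sigv st i ^+ 2).

(* tau stacks the lower part over the upper part; g stacks the upper
   constraints over the lower ones. *)
Definition gupper (u tau : 'cV[R]_(N + N)) : 'cV[R]_N :=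
  Ns%:R^-1 *: (\sum_s pospart (volt u - vmax net + xi st s + dsubmx tau))
  - beta net *: dsubmx tau.
Definition glower (u tau : 'cV[R]_(N + N)) : 'cV[R]_N :=
  Ns%:R^-1 *: (\sum_s pospart (vmin net - volt u - xi st s + usubmx tau))
  - beta net *: usubmx tau.
Definition gcon (u tau : 'cV[R]_(N + N)) : 'cV[R]_(N + N) :=
  col_mx (gupper u tau) (glower u tau).

(* The formula of g makes sense for every tau, so that gx is defined on the
   whole of R^(6N); its subgradients are the global ones. *)
Definition gx (x : var) : 'cV[R]_(N + N) := gcon (ublk x) (taublk x).

Definition domain : set var :=
  [set x | [/\ Xset st (ublk x), Xset st (zblk x) & orthant (taublk x)]].

Definition cost (x : var) : R := Copf st (ublk x) + Cse (zblk x).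

Definition optimal (x : var) : Prop :=
  let feasible y :=
    [/\ domain y, lev (gx y) 0 & volt (ublk y) = volt (zblk y)] in
  feasible x /\ forall y, feasible y -> cost x <= cost y.

Definition ftilde (v : R) (x : var) : R :=
  cost x + v / 2 * norm2 (taublk x) ^+ 2.

Definition lagrangian (phi v : R) (x : var) (l : 'cV[R]_(N + N)) : R :=
  cost x + dot l (gx x) + v / 2 * norm2 (taublk x) ^+ 2
  - phi / 2 * norm2 l ^+ 2.

(* The inner minimum over x, as an infimum in the extended reals. *)
Definition dual (phi v : R) (l : 'cV[R]_(N + N)) : \bar R :=
  ereal_inf [set (lagrangian phi v x l)%:E | x in domain].

Definition dual_optimal (phi v : R) (l : 'cV[R]_(N + N)) : Prop :=
  orthant l /\ forall m, orthant m -> (dual phi v m <= dual phi v l)%E.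

Definition saddle_point (phi v : R) (x : var) (l : 'cV[R]_(N + N)) : Prop :=
  [/\ domain x, orthant l,
      forall y, domain y -> lagrangian phi v x l <= lagrangian phi v y l
    & forall m, orthant m -> lagrangian phi v x m <= lagrangian phi v x l].

End Problem.

(* Main.v *)
(** Let [l] be the multiplier of the regularized saddle point [xeta] and [d] the
    distance from [xs] to [xeta]. Testing the saddle point against [m = 0] gives
    [phi / 2 * |l|^2 <= l . g(xeta)], whereas [l . g(xs) <= 0] because [xs] is
    feasible. Hence [L(xeta, l) <= L(xs, l)] yields
    [ftilde(xeta) + phi / 2 * |l|^2 <= ftilde(xs)]. Strong convexity at [xs] and
    Young's inequality bound [ftilde(xs) - ftilde(xeta)] by
    [Gf^2 / c - c / 4 * d^2], so [d^2 <= (2 Gf / c)^2 - 2 phi / c * |l|^2], which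
    is stronger than the claim since [leta = l]: the regularized dual function
    is strictly concave. *)

Require Import Defs.
From HB Require Import structures.
From mathcomp Require Import all_boot all_order all_algebra.
From mathcomp Require Import all_classical all_reals all_analysis.
From mathcomp Require Import ring lra.
Import Order.TTheory GRing.Theory Num.Theory.
Import numFieldNormedType.Exports.
Local Open Scope classical_set_scope.
Local Open Scope ring_scope.

Section EuclideanTheory.
Context {R : realType} {n : nat}.
Implicit Types x y : 'cV[R]_n.

Lemma dotE x y : dot x y = \sum_i x i 0 * y i 0.
Proof. by rewrite /dot mxE; apply: eq_bigr => i _; rewrite mxE. Qed.

Lemma dot0l y : dot 0 y = 0.
Proof. by rewrite dotE big1 // => i _; rewrite mxE mul0r. Qed.

Lemma norm2_ge0 x : 0 <= norm2 x.
Proof. exact: sqrtr_ge0. Qed.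

Lemma norm2_sqr x : norm2 x ^+ 2 = \sum_i x i 0 ^+ 2.
Proof. by rewrite sqr_sqrtr // sumr_ge0 // => i _; rewrite sqr_ge0. Qed.

Lemma norm2_0 : norm2 (0 : 'cV[R]_n) = 0.
Proof.
by rewrite /norm2 big1 ?sqrtr0 // => i _; rewrite mxE expr0n.
Qed.

Lemma norm2B_sqr x y : norm2 (x - y) ^+ 2 = norm2 (y - x) ^+ 2.
Proof.
by rewrite !norm2_sqr; apply: eq_bigr => i _; rewrite !mxE -sqrrN opprB.
Qed.

Lemma norm1_ge0 x : 0 <= norm1 x.
Proof. by apply: sumr_ge0 => i _; exact: normr_ge0. Qed.

Lemma dot_le0 {x y} : orthant x -> lev y 0 -> dot x y <= 0.
Proof.
move=> x0 y0; rewrite dotE sumr_le0 // => i _.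
by rewrite mulr_ge0_le0 //; [move: (x0 i) | move: (y0 i)]; rewrite mxE.
Qed.

(** Young's inequality: coordinatewise, the gap is a square divided by [c]. The weight [c / 4] is
    half of the [c / 2] in strong convexity, so a quadratic term [c / 4] survives their
    combination. *)
Lemma dot_young x y {c : R} : 0 < c ->
  - (norm2 x ^+ 2 / c + c / 4 * norm2 y ^+ 2) <= dot x y.
Proof.
move=> c0; rewrite !norm2_sqr dotE mulr_suml mulr_sumr -big_split /= -sumrN.
apply: ler_sum => i _; rewrite -subr_ge0.
suff -> : x i 0 * y i 0 - - (x i 0 ^+ 2 / c + c / 4 * y i 0 ^+ 2) =
          (x i 0 + c / 2 * y i 0) ^+ 2 / c.
  by rewrite divr_ge0 ?sqr_ge0 ?ltW.
by field; rewrite gt_eqF.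
Qed.

Lemma orthant0 : orthant (0 : 'cV[R]_n).
Proof. by move=> i. Qed.

Definition midpoint x y := 2^-1 *: (x + y).

Lemma orthant_midpoint {x y} : orthant x -> orthant y -> orthant (midpoint x y).
Proof.
move=> x0 y0 i; move: (x0 i) (y0 i); rewrite !mxE => xi yi.
by rewrite mulr_ge0 ?addr_ge0 // invr_ge0.
Qed.

Lemma dot_midpointl x y z : dot (midpoint x y) z = (dot x z + dot y z) / 2.
Proof.
rewrite !dotE -big_split /= mulr_suml; apply: eq_bigr => i _.
by rewrite !mxE; field.
Qed.

(** The parallelogram law, in a form that quantifies the strict convexity of the squared norm. *)
Lemma norm2_midpoint x y : norm2 (midpoint x y) ^+ 2 =
  (norm2 x ^+ 2 + norm2 y ^+ 2) / 2 - norm2 (x - y) ^+ 2 / 4.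
Proof.
rewrite !norm2_sqr -big_split /= !mulr_suml -sumrB; apply: eq_bigr => i _.
by rewrite !mxE; field.
Qed.

Lemma norm2B_sqr_le0 {x y} : norm2 (x - y) ^+ 2 <= 0 -> x = y.
Proof.
rewrite norm2_sqr => le0; apply/matrixP => i j; rewrite ord1; apply/eqP.
have ge0 k : true -> 0 <= (x - y) k 0 ^+ 2 by rewrite sqr_ge0.
have /eqP : \sum_k (x - y) k 0 ^+ 2 = 0.
  by apply/le_anti; rewrite le0 sumr_ge0.
rewrite psumr_eq0 // => /allP/(_ i); rewrite mem_index_enum => /(_ isT).
by rewrite sqrf_eq0 !mxE subr_eq0.
Qed.

End EuclideanTheory.

Section SaddlePoint.
Context {R : realType} {N Ns : nat}.
Context {net : network R N} {st : stage R N Ns} {phi v : R}.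
Hypothesis phi_gt0 : 0 < phi.

Local Notation L := (lagrangian net st phi v).

(** If [m] differed from [l], the midpoint of [m] and [l] would beat [l] in [L x]: the terms linear
    in the multiplier average out, and the regularization gains [phi / 8 * norm2 (m - l) ^+ 2]. *)
Lemma saddle_point_dual_unique {x l m} :
  saddle_point net st phi v x l -> dual_optimal net st phi v m -> m = l.
Proof.
move=> [domx l0 minx maxl] [m0 maxm].
(* Chain: [L x l] is a lower bound of [L y l] over the domain, hence at most the dual value at [l],
   then at [m], which is at most [L x m]. *)
have Lxm : L x l <= L x m.
  rewrite -lee_fin.
  apply: (@le_trans _ _ (dual net st phi v l)).
    by apply/ereal_infP => _ [y domy <-]; rewrite lee_fin minx.
  by apply: le_trans (maxm _ l0) _; apply: ereal_inf_lbound; exists x.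
have := maxl _ (orthant_midpoint m0 l0).
move: Lxm; rewrite /lagrangian dot_midpointl norm2_midpoint => Lxm Lmid.
apply: norm2B_sqr_le0; rewrite -(pmulr_rle0 _ phi_gt0); lra.
Qed.

Lemma saddle_point_ftilde {x l y} : saddle_point net st phi v x l ->
  domain st y -> lev (gx net st y) 0 ->
  ftilde net st v x + phi / 2 * norm2 l ^+ 2 <= ftilde net st v y.
Proof.
move=> [domx l0 minx maxl] domy gy0.
(* The [phi] terms cancel between [x] and [y]; the gain comes from the multiplier [0]. *)
have := dot_le0 l0 gy0; have := maxl _ orthant0; have := minx _ domy.
rewrite /lagrangian /ftilde dot0l norm2_0; lra.
Qed.

End SaddlePoint.

Theorem theorem2 (R : realType) (N Ns : nat) (net : network R N)
    (st : nat -> stage R N Ns) (phi v c Gf Gg : R)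
    (T : nat -> set 'cV[R]_(N + N))
    (Ns_gt0 : (0 < Ns)%N)
    (beta01 : 0 < beta net < 1)
    (phi_gt0 : 0 < phi) (v_gt0 : 0 < v)
    (c_gt0 : 0 < c) (Gf_gt0 : 0 < Gf) (Gg_gt0 : 0 < Gg)
    (Xconvex : forall t, (0 < t)%N ->
       convex_set (Xset (st t) : set (convex_lmodType 'cV[R]_(N + N))))
    (Xcompact : forall t, (0 < t)%N -> compact (Xset (st t)))
    (Copf_C1 : forall t, (0 < t)%N -> C1 (Copf (st t)))
    (Copf_sc : forall t, (0 < t)%N ->
       exists2 mu : R, 0 < mu & strongly_convex_on setT mu (Copf (st t)))
    (Copf_grad : forall t, (0 < t)%N -> exists B : R,
       forall u, Xset (st t) u -> norm2 (grad (Copf (st t)) u) <= B)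
    (sigp_gt0 : forall t, (0 < t)%N -> forall i, 0 < sigp (st t) i)
    (sigq_gt0 : forall t, (0 < t)%N -> forall i, 0 < sigq (st t) i)
    (sigv_gt0 : forall t, (0 < t)%N ->
       forall i, i \in Mv net -> 0 < sigv (st t) i)
    (slater : forall t, (0 < t)%N -> exists u tau,
       [/\ Xset (st t) u, orthant tau & lev (gcon net (st t) u tau) 0])
    (ftilde_sc : forall t, (0 < t)%N ->
       strongly_convex_on (domain (st t)) c (ftilde net (st t) v))
    (ftilde_grad : forall t, (0 < t)%N ->
       forall x, domain (st t) x -> T t (taublk x) ->
       norm2 (grad (ftilde net (st t) v) x) <= Gf)
    (g_subgrad : forall t, (0 < t)%N ->
       forall x, domain (st t) x ->
       forall J, subgradient_mx (gx net (st t)) x J -> opnorm2 J <= Gg) :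
  forall t, (0 < t)%N ->
  forall (xs xeta : 'cV[R]_((N + N) + (N + N) + (N + N)))
    (lv leta : 'cV[R]_(N + N)),
    optimal net (st t) xs ->
    T t (taublk xs) ->
    (exists l, saddle_point net (st t) phi v xeta l) ->
    dual_optimal net (st t) 0 v lv ->
    dual_optimal net (st t) phi v leta ->
    norm2 (xs - xeta) ^+ 2 <=
      (2 * (Gf + Gg * norm1 lv) / c) ^+ 2
      + phi / (2 * c) * (norm2 lv ^+ 2 - norm2 leta ^+ 2).
Proof.
move=> t t0 xs xeta lv leta [[domxs gxs _] _] Txs [l sp] _ dleta.
rewrite (saddle_point_dual_unique phi_gt0 sp dleta).
have fle := saddle_point_ftilde sp domxs gxs.
have [domxeta _ _ _] := sp.
have sc := ftilde_sc t t0 _ _ domxs domxeta.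
have young := dot_young (grad (ftilde net (st t) v) xs) (xeta - xs) c_gt0.
have gradle : norm2 (grad (ftilde net (st t) v) xs) ^+ 2 / c <= Gf ^+ 2 / c.
  rewrite ler_pM2r ?invr_gt0 // ler_pXn2r ?nnegrE ?norm2_ge0 ?(ltW Gf_gt0) //.
  (* Strong convexity was expanded at [xs], whose [tau] block lies in [T t] by [Txs]. *)
  exact: ftilde_grad.
set K := Gf + Gg * norm1 lv.
have GfK : Gf ^+ 2 / c <= K ^+ 2 / c.
  have K1 : Gf <= K by rewrite lerDl mulr_ge0 ?norm1_ge0 ?ltW.
  have K0 := le_trans (ltW Gf_gt0) K1.
  by rewrite ler_pM2r ?invr_gt0 // ler_pXn2r ?nnegrE ?(ltW Gf_gt0).
(* These signs allow adding the [lv] term and weakening the coefficient of [norm2 l ^+ 2] from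
   [- 2 * phi / c] to [- phi / (2 * c)]. *)
have lv2 : 0 <= phi * norm2 lv ^+ 2 by rewrite mulr_ge0 ?sqr_ge0 ?ltW.
have l2 : 0 <= phi * norm2 l ^+ 2 by rewrite mulr_ge0 ?sqr_ge0 ?ltW.
(* Scaling by [c] makes the goal linear in the quantities bounded above. *)
rewrite norm2B_sqr -(ler_pM2l c_gt0).
have -> : c * ((2 * K / c) ^+ 2 + phi / (2 * c) * (norm2 lv ^+ 2 - norm2 l ^+ 2))
  = 4 * (K ^+ 2 / c) + phi * (norm2 lv ^+ 2 - norm2 l ^+ 2) / 2.
  by field; rewrite gt_eqF.
lra.
Qed.
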